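(* Let $n$ be a positive integer, let $\mathbb{Y}$ be an arbitrary real Banach space, let $T\in\mathbb{L}(\ell_1^n,\mathbb{Y})$ with $\|T\|=1$, and let $k$ be a positive integer. Then $T$ is $k$-smooth if and only if, for some $1\le r\le n$, $M_T\cap \mathrm{Ext}(B_{\ell_1^n})=\{\pm x_1,\pm x_2,\ldots,\pm x_r\}$ (these being $2r$ distinct points), and there are positive integers $m_1,\ldots,m_r$ such that $Tx_i$ is $m_i$-smooth for each $1\le i\le r$ and $m_1+m_2+\cdots+m_r=k$.
   Context: All Banach spaces are real. $\ell_1^n$ is $\mathbb{R}^n$ with the norm $\|(a_1,\dots,a_n)\|=\sum_i|a_i|$. For a Banach space $\mathbb{X}$, $B_{\mathbb{X}}=\{x:\|x\|\le 1\}$, $S_{\mathbb{X}}=\{x:\|x\|=1\}$, $\mathbb{X}^*$ is the dual space, and $\mathrm{Ext}(B_{\mathbb{X}})$ is the set of extreme points of $B_{\mathbb{X}}$. $\mathbb{L}(\mathbb{X},\mathbb{Y})$ is the space of bounded linear operators with the operator norm. For $x\in S_{\mathbb{X}}$, $J(x)=\{x^*\in S_{\mathbb{X}^*}: x^*(x)=1\}$. A vector $x\in S_{\mathbb{X}}$ is $k$-smooth if $\dim\operatorname{span}J(x)=k$. An operator $T\in \mathbb{L}(\mathbb{X},\mathbb{Y})$ with $\|T\|=1$ is $k$-smooth if it is $k$-smooth as an element of the unit sphere of the Banach space $\mathbb{L}(\mathbb{X},\mathbb{Y})$, i.e. $\dim\operatorname{span}J(T)=k$ with $J(T)=\{f\in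 S_{\mathbb{L}(\mathbb{X},\mathbb{Y})^*}: f(T)=1\}$. The norm attainment set of $T$ is $M_T=\{x\in S_{\mathbb{X}}:\|Tx\|=\|T\|\}$. *)

(* Defs.v *)
From HB Require Import structures.
From mathcomp Require Import all_boot all_order all_algebra.
From mathcomp Require Import all_classical all_reals all_analysis.

Set Implicit Arguments.
Unset Strict Implicit.
Unset Printing Implicit Defensive.

Import Order.TTheory GRing.Theory Num.Theory.
Import numFieldNormedType.Exports.

Local Open Scope classical_set_scope.
Local Open Scope ring_scope.

Section LinearSpan.
Context {R : realType} {V : lmodType R}.

Definition linear_span (A : set V) : set V :=
  [set v | exists (m : nat) (c : 'I_m -> R) (e : 'I_m -> V),
    (forall i, A (e i)) /\ v = \sum_(i < m) c i *: e i].

Definition linearly_independent (m : nat) (e : 'I_m -> V) : Prop :=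
  forall c : 'I_m -> R, \sum_(i < m) c i *: e i = 0 -> forall i, c i = 0.

(* [U] has a basis of [k] vectors; false for every [k] when [U] is
   infinite-dimensional. *)
Definition has_dim (U : set V) (k : nat) : Prop :=
  exists e : 'I_k -> V, linearly_independent e /\ linear_span (range e) = U.

Definition extreme_points (A : set V) : set V :=
  [set x | A x /\ forall (y z : V) (t : R), A y -> A z -> 0 < t < 1 ->
    x = t *: y + (1 - t) *: z -> y = x /\ z = x].

End LinearSpan.

Definition unit_ball {R : realType} (V : normedModType R) : set V :=
  [set x | `|x| <= 1].

Definition unit_sphere {R : realType} (V : normedModType R) : set V :=
  [set x | `|x| = 1].

Arguments unit_ball {R} V _.
Arguments unit_sphere {R} V _.

Section BoundedOperators.
Context {R : realType} (V W : normedModType R).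

Definition bounded_linear (f : V -> W) : Prop :=
  linear f /\ exists M : R, forall x, `|f x| <= M * `|x|.

Definition bounded_linear_pred : {pred V -> W} := mem [set f | bounded_linear f].

Record bounded_operator := BoundedOperator {
  bounded_operator_fun :> V -> W;
  bounded_operatorP : bounded_operator_fun \in bounded_linear_pred }.

HB.instance Definition _ := [isSub for bounded_operator_fun].
HB.instance Definition _ := [Choice of bounded_operator by <:].

Lemma bounded_linear_submod_closed : submod_closed bounded_linear_pred.
Proof.
split.
  rewrite inE; split; first by move=> a x y /=; rewrite scaler0 addr0.
  by exists 0 => x; rewrite mul0r normr0.
move=> a f g; rewrite !inE => -[fl [M fM]] [gl [N gN]].
have fgE z : (a *: f + g) z = a *: f z + g z by [].
split.
  move=> b x y; rewrite !fgE fl gl !scalerDr addrACA.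
  by rewrite !scalerA [a * b]mulrC.
exists (`|a| * M + N) => x; rewrite fgE mulrDl.
rewrite (le_trans (ler_normD _ _))// lerD// normrZ -mulrA.
by rewrite ler_wpM2l.
Qed.

HB.instance Definition _ :=
  GRing.isSubmodClosed.Build R (V -> W) bounded_linear_pred
    bounded_linear_submod_closed.

HB.instance Definition _ := [SubChoice_isSubLmodule of bounded_operator by <:].

Lemma bounded_operator_linear (f : bounded_operator) : linear f.
Proof. by have := bounded_operatorP f; rewrite inE => -[]. Qed.

HB.instance Definition _ (f : bounded_operator) :=
  GRing.isLinear.Build R V W *:%R f (bounded_operator_linear f).

Definition operator_norm (f : bounded_operator) : R :=
  sup [set `|f x| | x in unit_ball V].

Lemma has_sup_operator_norm (f : bounded_operator) :
  has_sup [set `|f x| | x in unit_ball V].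
Proof.
split; first by exists `|f 0|; exists 0; rewrite // /unit_ball /= normr0.
have := bounded_operatorP f; rewrite inE => -[_ [M fM]].
exists `|M| => _ [x x1 <-]; rewrite (le_trans (fM x))//.
rewrite (le_trans (ler_norm _))// normrM normr_id.
by rewrite -[leRHS]mulr1 ler_wpM2l.
Qed.

Lemma operator_norm_ge (f : bounded_operator) x :
  `|f x| <= operator_norm f * `|x|.
Proof.
have [->|x0] := eqVneq x 0; first by rewrite linear0 !normr0 mulr0.
have nx : 0 < `|x| by rewrite normr_gt0.
rewrite -ler_pdivrMr// mulrC -[`|x|^-1]gtr0_norm ?invr_gt0// -normrZ -linearZ.
apply: sup_upper_bound; first exact: has_sup_operator_norm.
exists (`|x|^-1 *: x) => //.
by rewrite /unit_ball /= normrZ normfV normr_id mulVf ?gt_eqF.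
Qed.

Lemma operator_norm_le (f : bounded_operator) (M : R) :
  (forall x, `|x| <= 1 -> `|f x| <= M) -> operator_norm f <= M.
Proof.
move=> fM; apply: ge_sup; first by case: (has_sup_operator_norm f).
by move=> _ [x x1 <-]; exact: fM.
Qed.

Lemma operator_norm_ge0 (f : bounded_operator) : 0 <= operator_norm f.
Proof.
rewrite (le_trans (normr_ge0 (f 0)))//; apply: sup_upper_bound.
  exact: has_sup_operator_norm.
by exists 0; rewrite // /unit_ball /= normr0.
Qed.

Lemma bounded_operatorDE (f g : bounded_operator) x : (f + g) x = f x + g x.
Proof. by []. Qed.

Lemma bounded_operatorZE a (f : bounded_operator) x : (a *: f) x = a *: f x.
Proof. by []. Qed.

Lemma ler_operator_normD (f g : bounded_operator) :
  operator_norm (f + g) <= operator_norm f + operator_norm g.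
Proof.
apply: operator_norm_le => x x1.
rewrite bounded_operatorDE (le_trans (ler_normD _ _))//.
by rewrite lerD// (le_trans (operator_norm_ge _ _))// ler_piMr
  ?operator_norm_ge0.
Qed.

Lemma operator_normZ (a : R) (f : bounded_operator) :
  operator_norm (a *: f) = `|a| * operator_norm f.
Proof.
have le_normZ b (g : bounded_operator) :
    operator_norm (b *: g) <= `|b| * operator_norm g.
  apply: operator_norm_le => x x1; rewrite bounded_operatorZE normrZ ler_wpM2l//.
  by rewrite (le_trans (operator_norm_ge _ _))// ler_piMr ?operator_norm_ge0.
have [->|a0] := eqVneq a 0.
  by apply/eqP; rewrite eq_le le_normZ normr0 mul0r operator_norm_ge0.
apply/eqP; rewrite eq_le le_normZ/= -ler_pdivlMl ?normr_gt0//.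
by rewrite -[in leLHS](scalerK a0 f) (le_trans (le_normZ _ _))// normfV.
Qed.

Lemma operator_norm_eq0 (f : bounded_operator) : operator_norm f = 0 -> f = 0.
Proof.
move=> f0; apply/val_inj/funext => x; apply/eqP; rewrite -normr_le0.
by rewrite (le_trans (operator_norm_ge f x))// f0 mul0r.
Qed.

HB.instance Definition _ := Lmodule_isNormed.Build R bounded_operator
  ler_operator_normD operator_normZ operator_norm_eq0.

End BoundedOperators.

Section Smoothness.
Context {R : realType}.

Definition dual (V : normedModType R) : normedModType R :=
  bounded_operator V R^o.

Definition support_functionals (V : normedModType R) (x : V) : set (dual V) :=
  [set f : bounded_operator V R^o | unit_sphere (dual V) f /\ f x = 1].

Definition k_smooth (V : normedModType R) (k : nat) (x : V) : Prop :=
  unit_sphere V x /\ has_dim (linear_span (support_functionals x)) k.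

Definition norm_attainment (V W : normedModType R)
    (T : bounded_operator V W) : set V :=
  [set x | unit_sphere V x /\ `|T x| = `|T|].

End Smoothness.

Section L1.
Context (R : realType) (n : nat).

(* A separate type, because ['rV[R]_n] already carries the sup norm. *)
Definition l1 : Type := 'rV[R]_n.

HB.instance Definition _ := GRing.Lmodule.copy l1 'rV[R]_n.

Definition l1_norm (a : l1) : R := \sum_(i < n) `|(a : 'rV[R]_n) ord0 i|.

Lemma ler_l1_normD (a b : l1) : l1_norm (a + b) <= l1_norm a + l1_norm b.
Proof.
by rewrite -big_split/=; apply: ler_sum => i _; rewrite mxE ler_normD.
Qed.

Lemma l1_normZ (c : R) (a : l1) : l1_norm (c *: a) = `|c| * l1_norm a.
Proof. by rewrite mulr_sumr; apply: eq_bigr => i _; rewrite mxE normrM. Qed.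

Lemma l1_norm_eq0 (a : l1) : l1_norm a = 0 -> a = 0.
Proof.
move=> /eqP; rewrite psumr_eq0// => /allP a0; apply/rowP => i.
by rewrite mxE; apply/eqP; rewrite -normr_eq0; apply: a0; rewrite mem_index_enum.
Qed.

HB.instance Definition _ := Lmodule_isNormed.Build R l1
  ler_l1_normD l1_normZ l1_norm_eq0.

End L1.

(* Main.v *)
Require Import Defs.
From HB Require Import structures.
From mathcomp Require Import all_boot all_order all_algebra.
From mathcomp Require Import all_classical all_reals all_analysis.
From mathcomp Require Import ring lra.
Import Order.TTheory GRing.Theory Num.Theory.
Import numFieldNormedType.Exports.
Local Open Scope classical_set_scope.
Local Open Scope ring_scope.

Set Implicit Arguments.
Unset Strict Implicit.
Unset Printing Implicit Defensive.

(* An operator T on l1^n is the family of its columns T e_j, with norm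
   max_j |T e_j|; so a functional f on operators splits as
   f(S) = sum_j f_j(S e_j) with f_j in Y^*. If f supports T, then
   |f_j| = f_j(T e_j), so f_j = 0 unless |T e_j| = 1, and f_j is a nonnegative
   multiple of an element of J(T e_j) otherwise. Hence span J(T) is the direct
   sum of copies of span J(T e_j) over the j with |T e_j| = 1, that is, over the
   pairs of antipodal extreme points at which T attains its norm. Each summand
   is nonzero by the Hahn-Banach theorem. *)

(** * Spans, dimension and direct sums *)

Section LinearAlgebra.
Context {R : realType}.
Implicit Types V W : lmodType R.

Definition subspace {V} (U : set V) : Prop :=
  U 0 /\ forall (a : R) u v, U u -> U v -> U (a *: u + v).

Lemma subspaceZ {V} (U : set V) a u : subspace U -> U u -> U (a *: u).
Proof. by move=> [U0 UL] Uu; rewrite -[_ *: _]addr0; exact: UL. Qed.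

Lemma subspace_sum {V} (U : set V) (I : finType) (c : I -> R) (e : I -> V) :
  subspace U -> (forall i, U (e i)) -> U (\sum_i c i *: e i).
Proof.
move=> [U0 UL] Ue; elim/big_ind: _ => // [u v Uu Uv|i _].
  by rewrite -[u]scale1r; exact: UL.
by apply: subspaceZ.
Qed.

Lemma subspace_linear_span {V} (A : set V) : subspace (linear_span A).
Proof.
split.
  exists 0%N, (fun=> 0), (fun=> 0); split; first by case.
  by rewrite big_ord0.
move=> a _ _ [m1 [c1 [e1 [Ae1 ->]]]] [m2 [c2 [e2 [Ae2 ->]]]].
exists (m1 + m2)%N,
  (fun i => match fintype.split i with inl j => a * c1 j | inr j => c2 j end),
  (fun i => match fintype.split i with inl j => e1 j | inr j => e2 j end).
split; first by move=> i; case: (fintype.split i).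
rewrite big_split_ord/= scaler_sumr; congr (_ + _); apply: eq_bigr => i _.
  by rewrite (unsplitK (inl i)) scalerA.
by rewrite (unsplitK (inr i)).
Qed.

Lemma sub_linear_span {V} (A : set V) : A `<=` linear_span A.
Proof.
move=> v Av; exists 1%N, (fun=> 1), (fun=> v); split=> //.
by rewrite big_ord1 scale1r.
Qed.

Lemma linear_span_min {V} (A U : set V) :
  subspace U -> A `<=` U -> linear_span A `<=` U.
Proof.
by move=> sU AU _ [m [c [e [Ae ->]]]]; apply: subspace_sum => // i; exact: AU.
Qed.

(** [linear_span] allows lists of any length with repetitions. The combinations with one coefficient
    per index already form a subspace, so minimality of the span takes care of the regrouping. *)
Lemma linear_span_range {V} (I : finType) (e : I -> V) v :
  linear_span (range e) v <-> exists c : I -> R, v = \sum_i c i *: e i.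
Proof.
split=> [|[c ->]]; last first.
  apply: subspace_sum => [|i]; first exact: subspace_linear_span.
  by apply: sub_linear_span; exists i.
move: v; apply: linear_span_min.
  split; first by exists (fun=> 0); rewrite big1// => i _; rewrite scale0r.
  move=> a _ _ [c ->] [d ->]; exists (fun i => a * c i + d i).
  rewrite scaler_sumr -big_split/=; apply: eq_bigr => i _.
  by rewrite scalerA scalerDl.
move=> _ [i _ <-]; exists (fun j => (j == i)%:R).
rewrite (bigD1 i)//= eqxx scale1r big1 ?addr0// => j /negbTE ->.
by rewrite scale0r.
Qed.

(** The matrix expressing [e] in terms of [e'] is row-free, since a row vector killing it is a
    linear relation on [e]; its rank [m] is then at most its number of columns. *)
Lemma linearly_independent_leq {V} m k (e : 'I_m -> V) (e' : 'I_k -> V) :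
  linearly_independent e -> (forall i, linear_span (range e') (e i)) ->
  (m <= k)%N.
Proof.
move=> ie ee'.
have /choice[P eP] i : exists c : 'I_k -> R, e i = \sum_j c j *: e' j.
  exact/linear_span_range.
suff /eqP <- : row_free (\matrix_(i, j) P i j) by exact: rank_leq_col.
apply: inj_row_free => c cP0; apply/rowP => i; rewrite mxE.
apply: (ie (fun i => c ord0 i)).
under eq_bigr do rewrite eP scaler_sumr.
rewrite exchange_big big1//= => j _.
under eq_bigr do rewrite scalerA.
rewrite -scaler_suml; have /rowP/(_ j) := cP0; rewrite !mxE => cP0j.
suff -> : \sum_i0 c ord0 i0 * P i0 j = 0 by rewrite scale0r.
by rewrite -[RHS]cP0j; apply: eq_bigr => a _; rewrite mxE.
Qed.

Lemma has_dim_unique {V} (U : set V) m k : has_dim U m -> has_dim U k -> m = k.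
Proof.
move=> [e [ie eU]] [e' [ie' e'U]]; apply/eqP; rewrite eqn_leq.
apply/andP; split.
  apply: (linearly_independent_leq (e' := e') ie) => i.
  by rewrite e'U -eU; apply: sub_linear_span; exists i.
apply: (linearly_independent_leq (e' := e) ie') => i.
by rewrite eU -e'U; apply: sub_linear_span; exists i.
Qed.

(** This makes each span J(T e_j) finite-dimensional once span J(T) is. Injectivity bounds the size
    of independent families in [A] by [k], and one of maximal size is a basis. *)
Lemma has_dim_embedding {V W} (f : {linear V -> W}) (A : set V) (B : set W) k :
  subspace A -> has_dim B k -> (forall v, A v -> B (f v)) ->
  (forall v, f v = 0 -> v = 0) -> exists m, has_dim A m.
Proof.
move=> sA [e' [_ e'B]] AB finj.
pose P m := `[< exists e : 'I_m -> V,
  linearly_independent e /\ forall i, A (e i) >].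
have P0 : exists m, P m.
  exists 0%N; apply/asboolP; exists (fun=> 0).
  by split; [move=> c _ []|case].
have Pk m : P m -> (m <= k)%N.
  move=> /asboolP[e [ie Ae]].
  apply: (@linearly_independent_leq _ _ _ (f \o e) e').
    move=> c c0; apply: ie; apply: finj; rewrite -[RHS]c0 linear_sum.
    by apply: eq_bigr => i _; rewrite linearZ.
  by move=> i; rewrite e'B; exact: AB.
case: (ex_maxnP P0 Pk) => m /asboolP[e [ie Ae]] mmax.
exists m, e; split=> //; apply/seteqP; split.
  by apply: linear_span_min => // _ [i _ <-].
move=> u Au; apply: contrapT => nu.
suff : P m.+1 by move=> /mmax; rewrite ltnn.
(* The vector [u] is put in front of [e], at index [ord0]. In a relation, a nonzero coefficient of
   [u] would place [u] in the span of [e], and a zero one leaves a relation on [e]. *)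
apply/asboolP; exists (fun i => oapp e u (unlift ord0 i)); split; last first.
  by move=> i; case: unliftP => [j _|//]; exact: Ae.
move=> c; rewrite big_ord_recl unlift_none/=.
under eq_bigr do rewrite liftK/=.
have [c0|c0] := eqVneq (c ord0) 0.
  rewrite c0 scale0r add0r => /ie ci i.
  by case: (unliftP ord0 i) => [j ->|-> //]; exact: ci.
move=> /eqP; rewrite addr_eq0 => /eqP cu; exfalso; apply: nu.
apply/linear_span_range; exists (fun i => - ((c ord0)^-1 * c (lift ord0 i))).
rewrite -[LHS](scalerK c0) cu scalerN scaler_sumr -sumrN.
by apply: eq_bigr => i _; rewrite scalerA scaleNr.
Qed.

Lemma has_dim_card {V} (U : set V) (I : finType) (e : I -> V) :
  (forall c : I -> R, \sum_i c i *: e i = 0 -> forall i, c i = 0) ->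
  linear_span (range e) = U -> has_dim U #|I|.
Proof.
move=> ie eU; exists (e \o enum_val); split.
  move=> c c0 i; rewrite -[i]enum_valK; apply: (ie (c \o enum_rank)).
  rewrite -[RHS]c0 (reindex (enum_val : 'I_#|I| -> I)) /=;
    last exact/onW_bij/enum_val_bij.
  by apply: eq_bigr => j _; rewrite enum_valK.
rewrite -eU; congr linear_span; apply/seteqP; split=> _ [i _ <-].
  by exists (enum_val i).
by exists (enum_rank i) => //=; rewrite enum_rankK.
Qed.

Lemma has_dim_direct_sum {V W} {r : nat} (f : 'I_r -> {linear V -> W})
    (A : 'I_r -> set V) (B : set W) (m : 'I_r -> nat) :
  (forall i, has_dim (A i) (m i)) ->
  (forall w : 'I_r -> V, \sum_i f i (w i) = 0 -> forall i, w i = 0) ->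
  (forall v, B v <-> exists2 w : 'I_r -> V,
    forall i, A i (w i) & v = \sum_i f i (w i)) ->
  has_dim B (\sum_i m i)%N.
Proof.
move=> /fin_all_exists[e eA] finj BE.
pose E (p : {i : 'I_r & 'I_(m i)}) := f (tag p) (e (tag p) (tagged p)).
(* Grouping a combination by its first index lets [finj] separate the summands before the
   independence of each [e i] is used. *)
have sumE (c : {i : 'I_r & 'I_(m i)} -> R) :
    \sum_p c p *: E p =
    \sum_i f i (\sum_j c (existT (fun i => 'I_(m i)) i j) *: e i j).
  under [RHS]eq_bigr do rewrite linear_sum.
  rewrite sig_big_dep/=; apply: eq_bigr => -[i j] _.
  by rewrite linearZ.
have -> : (\sum_i m i)%N = #|{: {i : 'I_r & 'I_(m i)}}|.
  rewrite card_tagged sumnE big_map big_enum/=.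
  by apply: eq_bigr => i _; rewrite card_ord.
apply: (has_dim_card (e := E)).
  move=> c; rewrite sumE => /finj c0 [i j].
  have [ie _] := eA i.
  exact: (ie (fun j => c (existT (fun i => 'I_(m i)) i j)) (c0 i)).
apply/seteqP; split=> v.
  move=> /linear_span_range[c ->]; apply/BE.
  exists (fun i => \sum_j c (existT (fun i => 'I_(m i)) i j) *: e i j);
    last exact: sumE.
  move=> i; have [_ <-] := eA i; apply/linear_span_range.
  by exists (fun j => c (existT (fun i => 'I_(m i)) i j)).
move=> /BE[w Aw ->]; apply/linear_span_range.
have /fin_all_exists[c cw] i : exists c : 'I_(m i) -> R,
    w i = \sum_j c j *: e i j.
  by apply/linear_span_range; have [_ ->] := eA i.
exists (fun p => c (tag p) (tagged p)); rewrite sumE.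
by apply: eq_bigr => i _; rewrite cw.
Qed.
End LinearAlgebra.

(** * Norming functionals by the Hahn-Banach argument *)

Section HahnBanach.
Context {R : realType} {Y : normedModType R}.
Implicit Types (y v : Y) (r : R) (G : set (Y * R)).

(* The clause on [y] is guarded by nonemptiness so that the union of the empty
   chain qualifies. *)
Definition dominated_graph y G : Prop :=
  [/\ forall a v w r s, G (v, r) -> G (w, s) -> G (a *: v + w, a * r + s),
      forall v r, G (v, r) -> r <= `|v| &
      forall u, G u -> G (y, 1)].

(** The value [c] at [v0] must lie between all r - |v - v0| and all |w + v0| - s, for (v, r) and (w,
    s) in [G]. The triangle inequality puts the former below the latter, so the supremum of the
    former works. *)
Lemma dominated_graph_extend y G v0 : dominated_graph y G -> G (y, 1) ->
  exists c, dominated_graph y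
    [set u | exists v r a, G (v, r) /\ u = (v + a *: v0, r + a * c)].
Proof.
move=> [Glin Gle _] Gy1.
have GZ a v r : G (v, r) -> G (a *: v, a * r).
  move=> Gv; have G0 : G (0, 0).
    by have := Glin (-1) _ _ _ _ Gv Gv; rewrite scaleN1r mulN1r !addNr.
  by have := Glin a _ _ _ _ Gv G0; rewrite !addr0.
have GD v r w s : G (v, r) -> G (w, s) -> G (v + w, r + s).
  by move=> Gv Gw; have := Glin 1 _ _ _ _ Gv Gw; rewrite scale1r mul1r.
pose S := [set d | exists v r, G (v, r) /\ d = r - `|v - v0|].
have Sub v r : G (v, r) -> ubound S (`|v + v0| - r).
  move=> Gv _ [w [s [Gw ->]]].
  have := Gle _ _ (GD _ _ _ _ Gv Gw).
  have := ler_normD (v + v0) (w - v0); rewrite addrACA subrr addr0; lra.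
have S0 : S !=set0 by exists (1 - `|y - v0|), y, 1.
have hS : has_sup S by split=> //; exists (`|y + v0| - 1); exact: Sub.
exists (sup S).
have cge v r : G (v, r) -> r - sup S <= `|v - v0|.
  move=> Gv; have : r - `|v - v0| <= sup S.
    by apply: sup_upper_bound => //; exists v, r.
  lra.
have cle v r : G (v, r) -> r + sup S <= `|v + v0|.
  by move=> Gv; have := ge_sup S0 (Sub _ _ Gv); lra.
split.
- move=> a _ _ _ _ [v [r [b [Gv [-> ->]]]]] [w [s [d [Gw [-> ->]]]]].
  exists (a *: v + w), (a * r + s), (a * b + d); split; first exact: Glin.
  congr (_, _); last by ring.
  by rewrite scalerDr scalerDl scalerA addrACA.
- move=> _ _ [v [r [a [Gv [-> ->]]]]].
  (* Dividing by |a| reduces domination to a = -1 and a = 1, that is, to [cge] and [cle]. *)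
  have [a0|a0|->] := ltgtP a 0;
    last by rewrite scale0r mul0r !addr0; exact: Gle.
    have Na0 : 0 < - a by rewrite oppr_gt0.
    have -> : v + a *: v0 = (- a) *: ((- a)^-1 *: v - v0).
      by rewrite scalerBr scalerA divff ?gt_eqF// scale1r scaleNr opprK.
    rewrite normrZ gtr0_norm// -ler_pdivrMl//.
    apply: le_trans (cge _ _ (GZ (- a)^-1 _ _ Gv)).
    by rewrite mulrDr invrN !mulNr mulrA mulVf ?lt_eqF// mul1r.
  have -> : v + a *: v0 = a *: (a^-1 *: v + v0).
    by rewrite scalerDr scalerA divff ?gt_eqF// scale1r.
  rewrite normrZ gtr0_norm// -ler_pdivrMl//.
  apply: le_trans (cle _ _ (GZ a^-1 _ _ Gv)).
  by rewrite mulrDr mulrA mulVf ?gt_eqF// mul1r.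
- by move=> _ _; exists y, 1, 0; rewrite scale0r mul0r !addr0.
Qed.

(** Zorn's lemma gives a maximal dominated graph; one-dimensional extension makes it total, and
    domination makes it single-valued. *)
Lemma norming_functional y : `|y| = 1 ->
  exists f : Y -> R,
    [/\ linear (f : Y -> R^o), forall v, `|f v| <= `|v| & f y = 1].
Proof.
move=> y1.
have [|G [[Glin Gle Gne] Gmax]] :=
    @Zorn_bigcup (Y * R)%type (dominated_graph y).
  move=> F FP Ftot; split.
  - move=> a v w r s [X FX Xv] [Z FZ Zw].
    have [XZ|ZX] := Ftot _ _ FX FZ.
      by exists Z => //; have [ZL _ _] := FP _ FZ; apply: ZL => //; exact: XZ.
    by exists X => //; have [XL _ _] := FP _ FX; apply: XL => //; exact: ZX.
  - by move=> v r [X /FP[_ + _]] => /[apply].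
  - by move=> u [X FX Xu]; exists X => //; have [_ _ h] := FP _ FX; exact: h Xu.
have Gy1 : G (y, 1).
  (* Without [(y, 1)] the guarded clause makes [G] empty, and the graph of a y |-> a on the line
     through [y] is strictly larger. *)
  apply: contrapT => nG; have G0 u : ~ G u by move=> /Gne.
  apply: (Gmax [set u | exists a : R, u = (a *: y, a)]).
    split; first by move=> u /G0.
    by move=> /(_ (y, 1)) h; apply/nG/h; exists 1; rewrite scale1r.
  split.
  - move=> a _ _ _ _ [b [-> ->]] [c [-> ->]]; exists (a * b + c).
    by rewrite scalerA scalerDl.
  - by move=> _ _ [a [-> ->]]; rewrite normrZ y1 mulr1 ler_norm.
  - by move=> _ _; exists 1; rewrite scale1r.
have Gtot v : exists r, G (v, r).
  have [c cP] := dominated_graph_extend v (And3 Glin Gle Gne) Gy1.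
  have GG : G `<=`
      [set u | exists w r a, G (w, r) /\ u = (w + a *: v, r + a * c)].
    by move=> [w r] Gw; exists w, r, 0; rewrite scale0r mul0r !addr0.
  apply: contrapT => nG; apply: (Gmax _ _ cP); split=> // /(_ (v, c)) h.
  apply: nG; exists c; apply: h.
  have := Glin (-1) _ _ _ _ Gy1 Gy1; rewrite scaleN1r mulN1r !addNr => G0.
  by exists 0, 0, 1; rewrite scale1r mul1r !add0r.
have GN v r w s : G (v, r) -> G (w, s) -> G (w - v, s - r).
  move=> Gv Gw; have := Glin (-1) _ _ _ _ Gv Gw.
  by rewrite scaleN1r mulN1r ![- _ + _]addrC.
(* The difference of two values at [v] is a value at 0, hence at most 0, in either order. *)
have Guniq v r s : G (v, r) -> G (v, s) -> r = s.
  move=> Gr Gs; have := Gle _ _ (GN _ _ _ _ Gr Gs).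
  have := Gle _ _ (GN _ _ _ _ Gs Gr); rewrite subrr normr0; lra.
have /choice[f fG] := Gtot.
exists f; split.
- move=> a v w; apply: (Guniq (a *: v + w)) => //; exact: Glin.
(* The lower bound on [f v] is domination at [- v]. *)
- move=> v; rewrite ler_norml Gle// andbT lerNl -normrN.
  apply: Gle; have G0 := GN _ _ _ _ (fG v) (fG v); rewrite !subrr in G0.
  by have := GN _ _ _ _ (fG v) G0; rewrite !sub0r.
- exact: (Guniq y).
Qed.

End HahnBanach.

(** * Support functionals and functionals on operator spaces *)

Section Operators.
Context {R : realType}.
Implicit Types V W : normedModType R.

Definition operator_of {V W} (f : V -> W) (bf : bounded_linear f) :
  bounded_operator V W := BoundedOperator (mem_set bf).

Lemma ler_norm_operator V W (f : bounded_operator V W) v :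
  `|f v| <= `|f| * `|v|.
Proof. exact: operator_norm_ge. Qed.

Lemma operator_sumE V W (I : finType) (f : I -> bounded_operator V W) v :
  (\sum_i f i) v = \sum_i f i v.
Proof. by elim/big_ind2: _ => // f1 v1 f2 v2 <- <-. Qed.

(** A value 1 on the unit ball forces norm at least 1, so only upper bounds on norms remain to be
    checked. *)
Lemma support_functionalsP V (v : V) (g : dual V) :
  `|v| <= 1 -> `|g| <= 1 -> (g : bounded_operator V R^o) v = 1 ->
  support_functionals v g.
Proof.
move=> v1 g1 gv; split=> //; apply/le_anti; rewrite g1/=.
have := ler_norm_operator (g : bounded_operator V R^o) v.
rewrite gv [X in X <= _](normr1 R) => /le_trans; apply.
by rewrite ler_piMr.
Qed.

Lemma support_functionals_neq0 V (v : V) : `|v| = 1 ->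
  support_functionals v !=set0.
Proof.
move=> v1; have [f [fL fle fv]] := norming_functional v1.
have bf : bounded_linear (f : V -> R^o).
  by split=> //; exists 1 => u; rewrite mul1r; exact: fle.
exists (operator_of bf : dual V); apply: support_functionalsP => //.
  by rewrite v1.
by apply: operator_norm_le => u u1; exact: le_trans (fle u) u1.
Qed.

(** By Hahn-Banach J(v) contains a functional, which is nonzero because its value at [v] is 1. *)
Lemma k_smooth_gt0 V m (v : V) : k_smooth m v -> (0 < m)%N.
Proof.
case: m => // -[v1 [e [_ eJ]]].
have [g Jg] := support_functionals_neq0 v1.
have : linear_span (support_functionals v) g by exact: sub_linear_span.
rewrite -eJ => /linear_span_range[c]; rewrite big_ord0 => g0.
move: Jg => [_ +]; rewrite g0 => /eqP; rewrite eq_sym.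
by move=> /eqP h; have := oner_neq0 R; rewrite h eqxx.
Qed.

Lemma point_functional_bounded V W (v : V) (g : bounded_operator W R^o) :
  bounded_linear (fun S : bounded_operator V W => g (S v) : R^o).
Proof.
split=> [a S1 S2|]; first by rewrite bounded_operatorDE linearD linearZ.
exists (`|g| * `|v|) => S; rewrite (le_trans (ler_norm_operator _ _))//.
by rewrite -mulrA ler_wpM2l// mulrC; exact: ler_norm_operator.
Qed.

(** The elementary tensor of [v] and [g], seen as a functional on operators; span J(T) is assembled
    from these. *)
Definition point_functional V W (v : V) (g : dual W) :
    dual (bounded_operator V W) :=
  operator_of (point_functional_bounded v g).

Lemma point_functional_linear V W (v : V) :
  linear (@point_functional V W v).
Proof. by move=> a g h; apply/val_inj/funext => S. Qed.

HB.instance Definition _ V W (v : V) := GRing.isLinear.Build R (dual W)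
  (dual (bounded_operator V W)) *:%R (@point_functional V W v)
  (@point_functional_linear V W v).

Lemma support_point_functional V W (T : bounded_operator V W) v g :
  `|T| = 1 -> `|v| = 1 -> support_functionals (T v) g ->
  support_functionals T (point_functional v g).
Proof.
move=> T1 v1 [g1 gTv]; apply: support_functionalsP => //; first by rewrite T1.
apply: operator_norm_le => S S1.
rewrite (le_trans (ler_norm_operator (g : bounded_operator W R^o) _))//.
rewrite g1 mul1r (le_trans (ler_norm_operator _ _))// v1 mulr1.
exact: S1.
Qed.

End Operators.

(** * Operators on l1 and their columns *)

Section L1Operators.
Context {R : realType} {n : nat} {Y : normedModType R}.
Implicit Types (i j : 'I_n) (y : Y) (S T : bounded_operator (l1 R n) Y).

Definition l1_unit j : l1 R n := delta_mx ord0 j.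

Lemma l1_normE (a : l1 R n) : `|a| = \sum_i `|(a : 'rV[R]_n) ord0 i|.
Proof. by []. Qed.

Lemma l1_coord_le (a : l1 R n) i : `|(a : 'rV[R]_n) ord0 i| <= `|a|.
Proof. by rewrite l1_normE (bigD1 i)//= lerDl sumr_ge0. Qed.

Lemma l1_unitE i j : (l1_unit i : 'rV[R]_n) ord0 j = (j == i)%:R.
Proof. by rewrite mxE eqxx. Qed.

Lemma norm_l1_unit j : `|l1_unit j| = 1.
Proof.
rewrite l1_normE (bigD1 j)//= l1_unitE eqxx normr1 big1 ?addr0//.
by move=> i /negbTE ij; rewrite l1_unitE ij normr0.
Qed.

Lemma l1_decomposition (a : l1 R n) :
  a = \sum_i (a : 'rV[R]_n) ord0 i *: l1_unit i.
Proof. exact: row_sum_delta. Qed.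

Lemma l1_operatorE S a : S a = \sum_i (a : 'rV[R]_n) ord0 i *: S (l1_unit i).
Proof.
rewrite [in LHS](l1_decomposition a) linear_sum.
by apply: eq_bigr => i _; rewrite linearZ.
Qed.

(** The image of [a] combines the columns with coefficients whose absolute values sum to the norm of
    [a]. *)
Lemma l1_operator_norm_le S (M : R) : 0 <= M ->
  (forall i, `|S (l1_unit i)| <= M) -> `|S| <= M.
Proof.
move=> M0 SM; apply: operator_norm_le => a a1; rewrite l1_operatorE.
rewrite (le_trans (ler_norm_sum _ _ _))//.
apply: (@le_trans _ _ (`|a| * M)); last by rewrite ler_piMl.
rewrite l1_normE mulr_suml; apply: ler_sum => i _.
by rewrite normrZ ler_wpM2l.
Qed.

Lemma l1_operator_le1 S : `|S| <= 1 -> forall i, `|S (l1_unit i)| <= 1.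
Proof.
by move=> S1 i; rewrite (le_trans (ler_norm_operator _ _))// norm_l1_unit mulr1.
Qed.

Lemma coord_operator_bounded j y :
  bounded_linear (fun a : l1 R n => (a : 'rV[R]_n) ord0 j *: y).
Proof.
split=> [c a b|]; first by rewrite !mxE scalerDl scalerA.
exists `|y| => a; rewrite normrZ mulrC ler_wpM2l//; exact: l1_coord_le.
Qed.

Definition coord_operator j y := operator_of (coord_operator_bounded j y).

Lemma coord_operatorE j y i :
  coord_operator j y (l1_unit i) = (j == i)%:R *: y.
Proof. by rewrite /coord_operator/= l1_unitE. Qed.

Lemma coord_operator_norm_le j y : `|coord_operator j y| <= `|y|.
Proof.
apply: l1_operator_norm_le => // i; rewrite coord_operatorE.
by case: eqP => _; rewrite ?scale1r ?scale0r ?normr0.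
Qed.

Lemma operator_decomposition S : S = \sum_j coord_operator j (S (l1_unit j)).
Proof.
by apply/val_inj/funext => a; rewrite /= operator_sumE -l1_operatorE.
Qed.

Lemma slot_functional_bounded j
    (f : bounded_operator (bounded_operator (l1 R n) Y) R^o) :
  bounded_linear (fun y => f (coord_operator j y) : R^o).
Proof.
split=> [a y z|].
  rewrite -linearZ -linearD; congr (f _); apply/val_inj/funext => b /=.
  rewrite -[RHS]/(a *: ((b : 'rV[R]_n) ord0 j *: y) +
    (b : 'rV[R]_n) ord0 j *: z).
  by rewrite scalerDr !scalerA mulrC.
exists `|f| => y; rewrite (le_trans (ler_norm_operator _ _))// ler_wpM2l//.
exact: coord_operator_norm_le.
Qed.

(** The component f_j in the splitting of [f] along columns: [f] restricted to operators whose only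
    nonzero column is the [j]-th. *)
Definition slot_functional j (f : dual (bounded_operator (l1 R n) Y)) :
    dual Y :=
  operator_of (slot_functional_bounded j f).

Lemma slot_functional_sum (f : dual (bounded_operator (l1 R n) Y)) :
  f = \sum_j point_functional (l1_unit j) (slot_functional j f).
Proof.
apply/val_inj/funext => S; rewrite /= operator_sumE.
by rewrite [in LHS](operator_decomposition S) linear_sum.
Qed.

(* Replacing the [j]-th column of [T] by any [y] in the unit ball keeps the
   operator norm at most 1, so [f] cannot increase: the [j]-th slot of [f] has
   its norm attained at the [j]-th column of [T]. *)
Lemma slot_functional_norm_le T f j : `|T| = 1 -> support_functionals T f ->
  `|slot_functional j f| <= slot_functional j f (T (l1_unit j)).
Proof.
move=> T1 [f1 fT]; set c := slot_functional j f _.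
have le_c y : `|y| <= 1 -> slot_functional j f y <= c.
  move=> y1.
  pose S := T - coord_operator j (T (l1_unit j)) + coord_operator j y.
  have S1 : `|S| <= 1.
    apply: l1_operator_norm_le => // i.
    have -> : S (l1_unit i) = T (l1_unit i) -
      coord_operator j (T (l1_unit j)) (l1_unit i) +
      coord_operator j y (l1_unit i).
      by [].
    rewrite !coord_operatorE; case: eqP => [<-|_].
      by rewrite !scale1r subrr add0r.
    by rewrite !scale0r subr0 addr0 l1_operator_le1// T1.
  have : (f : bounded_operator _ R^o) S <= 1.
    rewrite (le_trans (ler_norm _))//.
    rewrite (le_trans (ler_norm_operator (f : bounded_operator _ R^o) S))//.
    by rewrite f1 mul1r.
  have -> : (f : bounded_operator _ R^o) S = 1 - c + slot_functional j f y.
    by rewrite -fT linearD linearB.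
  lra.
apply: operator_norm_le => y y1; rewrite ler_norml le_c// andbT lerNl.
by rewrite -linearN le_c// normrN.
Qed.

(** If the value [c] of the slot at T e_j is 0, the slot vanishes; otherwise dividing by [c] gives
    norm at most 1 and value 1 at T e_j. *)
Lemma slot_functional_span T f j : `|T| = 1 -> support_functionals T f ->
  linear_span (support_functionals (T (l1_unit j))) (slot_functional j f).
Proof.
move=> T1 Jf; have := slot_functional_norm_le j T1 Jf.
set g := slot_functional j f; set c := g _ => gc.
have c0 : 0 <= c by rewrite (le_trans _ gc).
have [c_eq0|cn0] := eqVneq c 0.
  have -> : g = 0 by apply/eqP; rewrite -normr_le0 -c_eq0.
  by have [] := subspace_linear_span (support_functionals (T (l1_unit j))).
have {cn0}c0 : 0 < c by rewrite lt_def cn0.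
rewrite -[g](@scalerKV _ _ c) ?gt_eqF//.
apply: subspaceZ; first exact: subspace_linear_span.
apply: sub_linear_span; apply: support_functionalsP.
- by rewrite l1_operator_le1 ?T1.
- by rewrite normrZ gtr0_norm ?invr_gt0// ler_pdivrMl// mulr1.
- by rewrite -[LHS]/(c^-1 * c) mulVf ?gt_eqF.
Qed.

(** The chain |g| <= g(T e_j) <= |g| |T e_j| with |T e_j| < 1 forces g = 0. *)
Lemma slot_functional_eq0 T f j : `|T| = 1 -> support_functionals T f ->
  `|T (l1_unit j)| <> 1 -> slot_functional j f = 0.
Proof.
move=> T1 Jf Tj; have := slot_functional_norm_le j T1 Jf.
set g := slot_functional j f; set c := g _ => gc.
apply/eqP; rewrite -normr_le0.
have Tlt : `|T (l1_unit j)| < 1.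
  by rewrite lt_def l1_operator_le1 ?T1// andbT eq_sym; exact/eqP.
have : c <= `|g| * `|T (l1_unit j)|.
  by rewrite (le_trans (ler_norm _))//; exact: ler_norm_operator.
have := normr_ge0 g; nra.
Qed.

End L1Operators.

(** * Extreme points of the unit ball of l1 *)

Section ExtremePoints.
Context {R : realType} {n : nat}.

Lemma norm_eq1 (s : R) : `|s| = 1 -> s = 1 \/ s = -1.
Proof.
by move=> /eqP; rewrite eqr_norml ler01 andbT => /orP[]/eqP; [left|right].
Qed.

(** A coordinate of absolute value 1 exhausts the norm, so all the others vanish. *)
Lemma l1_ball_coord (a : l1 R n) j (s : R) : `|a| <= 1 -> `|s| = 1 ->
  (a : 'rV[R]_n) ord0 j = s -> a = s *: l1_unit j.
Proof.
move=> a1 s1 aj; apply/rowP => i; rewrite mxE l1_unitE.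
have [->|ij] := eqVneq i j; first by rewrite mulr1.
apply/eqP; rewrite mulr0 -normr_le0; move: a1.
rewrite l1_normE (bigD1 j)//= aj s1 (bigD1 i)//=.
have : 0 <= \sum_(k < n | (k != j) && (k != i)) `|(a : 'rV[R]_n) ord0 k|.
  exact: sumr_ge0.
lra.
Qed.

Lemma convex_eq_max (t a b : R) : 0 < t < 1 -> a <= 1 -> b <= 1 ->
  1 = t * a + (1 - t) * b -> a = 1 /\ b = 1.
Proof. by move=> /andP[t0 t1] a1 b1 E; split; nra. Qed.

(** At a signed unit vector the [j]-th coordinate is extremal in [-1, 1], which pins down both ends
    of a segment through it. Conversely, a point that is not a signed unit vector splits along one
    of its nonzero coordinates. *)
Lemma extreme_points_l1 : (0 < n)%N ->
  extreme_points (unit_ball (l1 R n)) =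
  [set a | exists j s, `|s| = 1 /\ a = s *: l1_unit j].
Proof.
move=> n0; apply/seteqP; split=> a; last first.
  move=> [j [s [s1 ->]]]; split.
    by rewrite /unit_ball/= normrZ s1 norm_l1_unit mulr1.
  move=> y z t y1 z1 t01 /rowP/(_ j); rewrite !mxE !eqxx mulr1 => E.
  have yj := le_trans (l1_coord_le y j) y1.
  have zj := le_trans (l1_coord_le z j) z1.
  move: yj zj; rewrite !ler_norml => /andP[yl yr] /andP[zl zr].
  suff [ys zs] : (y : 'rV[R]_n) ord0 j = s /\ (z : 'rV[R]_n) ord0 j = s.
    by split; apply: l1_ball_coord.
  have [s_eq|s_eq] := norm_eq1 s1; rewrite s_eq in E *.
    exact: convex_eq_max E.
  have [||||] := @convex_eq_max t (- (y : 'rV[R]_n) ord0 j)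
    (- (z : 'rV[R]_n) ord0 j) => //.
  - by rewrite lerNl.
  - by rewrite lerNl.
  - by rewrite !mulrN -opprD -E opprK.
  - by move=> /eqP; rewrite eqr_oppLR => /eqP -> /eqP;
      rewrite eqr_oppLR => /eqP.
move=> [a1 aext].
have [j aj] : exists j, (a : 'rV[R]_n) ord0 j != 0.
  (* If all coordinates vanished, [a] would be the midpoint of [e] and [- e], with [n0] providing
     the index of [e]. *)
  apply: contrapT => na; pose e : l1 R n := l1_unit (Ordinal n0).
  have [||||] := aext e (- e) 2^-1.
  - by rewrite /unit_ball/= norm_l1_unit.
  - by rewrite /unit_ball/= normrN norm_l1_unit.
  - by lra.
  - have -> : 1 - 2^-1 = 2^-1 :> R by lra.
    rewrite scalerN subrr; apply/rowP => i; rewrite mxE.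
    by apply/eqP; apply: contrapT => /negP ai; apply: na; exists i.
  - move=> ea _; apply: na; exists (Ordinal n0).
    by rewrite -ea l1_unitE eqxx oner_neq0.
set c := (a : 'rV[R]_n) ord0 j in aj.
have c_gt0 : 0 < `|c| by rewrite normr_gt0.
pose s := c / `|c|.
have s1 : `|s| = 1 by rewrite normrM normfV normr_id divff ?gt_eqF.
have cs : c = `|c| * s by rewrite mulrC divfK ?gt_eqF.
exists j, s; split=> //.
have [c1|c1] := eqVneq `|c| 1.
  by apply: l1_ball_coord => //; rewrite -[LHS]/c cs c1 mul1r.
have c_lt1 : `|c| < 1.
  by rewrite lt_def eq_sym c1 (le_trans (l1_coord_le a j)).
(* Removing the [j]-th coordinate of [a] and rescaling gives a = |c| (s e_j) + (1 - |c|) z, a proper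
   convex combination, so extremality yields a = s e_j. *)
pose z := (1 - `|c|)^-1 *: (a - c *: l1_unit j).
have [||||->] // := aext (s *: l1_unit j) z `|c|.
- by rewrite /unit_ball/= normrZ s1 norm_l1_unit mulr1.
- rewrite /unit_ball/= normrZ gtr0_norm ?invr_gt0 ?subr_gt0//.
  rewrite ler_pdivrMl ?subr_gt0// mulr1.
  have -> : `|a - c *: l1_unit j| = `|a| - `|c|.
    rewrite !l1_normE (bigD1 j)//= [in RHS](bigD1 j)//= !mxE !eqxx mulr1 subrr.
    rewrite normr0 add0r addrAC subrr add0r; apply: eq_bigr => i /negbTE ij.
    by rewrite !mxE ij andbF mulr0 subr0.
  by rewrite lerD2r.
- by rewrite c_gt0.
- by rewrite scalerA -cs scalerA divff ?scale1r ?subr_eq0 1?eq_sym//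
    addrC subrK.
Qed.

End ExtremePoints.

(** * The direct sum decomposition of span J(T) *)

Section Smoothness.
Context {R : realType} {n : nat} {Y : normedModType R}.
Implicit Type T : bounded_operator (l1 R n) Y.

Lemma point_functional_coord (a : l1 R n) j (g : dual Y) (y : Y) :
  (point_functional a g : bounded_operator (bounded_operator (l1 R n) Y) R^o)
    (coord_operator j y) = (a : 'rV[R]_n) ord0 j * g y.
Proof. by rewrite /= linearZ. Qed.

(** Evaluating at [coord_operator j y] recovers [g y]. *)
Lemma point_functional_inj j (g : dual Y) :
  point_functional (l1_unit j : l1 R n) g = 0 -> g = 0.
Proof.
move=> g0; apply/val_inj/funext => y.
have := point_functional_coord (l1_unit j) j g y.
by rewrite g0 l1_unitE eqxx mul1r.
Qed.

Section SignedUnits.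
Context (T : bounded_operator (l1 R n) Y) {r : nat} (j : 'I_r -> 'I_n)
  (s : 'I_r -> R).
Hypotheses (T1 : `|T| = 1) (j_inj : injective j) (s1 : forall i, `|s i| = 1)
  (jP : forall l, `|T (l1_unit l)| = 1 <-> exists i, l = j i).

Let x i : l1 R n := s i *: l1_unit (j i).

(** The direct sum is taken along the maps sending g to the tensor of x_i and g. The signs [s] allow
    either point of each antipodal pair, as the converse half of the theorem requires. *)
Lemma has_dim_support_l1 (m : 'I_r -> nat) :
  (forall i, has_dim (linear_span (support_functionals (T (x i)))) (m i)) ->
  has_dim (linear_span (support_functionals T)) (\sum_i m i)%N.
Proof.
have ss i : s i * s i = 1.
  by have [->|->] := norm_eq1 (s1 i); rewrite ?mulr1 ?mulrNN ?mulr1.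
move=> dm.
apply: (has_dim_direct_sum (f := fun i => point_functional (x i)) dm).
  move=> w w0 i; apply/val_inj/funext => y.
  (* The test operator has the single column [s i *: y] at [j i]: it kills every other summand, as
     [j] is injective, and returns [w i y]. *)
  have : (\sum_i point_functional (x i) (w i) : bounded_operator _ R^o)
    (coord_operator (j i) (s i *: y)) = 0 by rewrite w0.
  rewrite operator_sumE (bigD1 i)//= big1 => [|l li]; last first.
    rewrite !mxE/= (inj_eq j_inj) eq_sym (negbTE li) mulr0 scale0r linear0.
    by [].
  by rewrite addr0 !mxE !eqxx mulr1 scalerA ss scale1r.
have spanU := subspace_linear_span (support_functionals T).
move=> f; split; last first.
  move=> [w Jw ->].
  have -> : \sum_i point_functional (x i) (w i) =
      \sum_i (1 : R) *: point_functional (x i) (w i).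
    by apply: eq_bigr => i _; rewrite scale1r.
  apply: (subspace_sum _ spanU) => i.
  move: (w i) (Jw i); apply: linear_span_min.
    split; first by rewrite /= linear0; case: spanU.
    by move=> a g h Ug Uh; rewrite /= linearP; case: spanU => _; apply.
  move=> g Jg; apply: sub_linear_span; apply: support_point_functional => //.
  by rewrite normrZ s1 norm_l1_unit mulr1.
move: f; apply: linear_span_min.
  split.
    exists (fun=> 0); last by rewrite big1// => i _; rewrite linear0.
    move=> i.
    by have [] := subspace_linear_span (support_functionals (T (x i))).
  move=> a _ _ [v Jv ->] [w Jw ->]; exists (fun i => a *: v i + w i).
    move=> i.
    by have [_] := subspace_linear_span (support_functionals (T (x i))); apply.
  rewrite scaler_sumr -big_split/=; apply: eq_bigr => i _.
  by rewrite linearP.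
(* Since s_i s_i = 1, the sign cancels against the one in x_i; it also turns J(T e_(j i)) into J(T
   x_i). *)
move=> f Jf; exists (fun i => s i *: slot_functional (j i) f).
  move=> i; have := slot_functional_span (j i) T1 Jf.
  move: (slot_functional _ _) => g; move: g; apply: linear_span_min.
    have [J0 JL] := subspace_linear_span (support_functionals (T (x i))).
    split=> [|a g h Jg Jh]; first by rewrite /= scaler0.
    by rewrite /= scalerDr scalerA mulrC -scalerA; exact: JL.
  move=> g [g1 gT]; apply: sub_linear_span; split.
    by rewrite /unit_sphere/= normrZ s1 mul1r.
  rewrite /x linearZ -[LHS]/(s i * g (s i *: T (l1_unit (j i)))).
  by rewrite linearZ/= gT -[_ *: _]/(s i * 1) mulr1 ss.
rewrite [LHS]slot_functional_sum.
(* Columns outside the range of [j] have norm different from 1, so their slots vanish; the rest are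
   reindexed by [j]. *)
rewrite (bigID (mem (codom j)))/= [X in _ + X]big1 ?addr0;
    last first.
  move=> l lj; rewrite (slot_functional_eq0 T1 Jf) ?linear0// => /jP[i li].
  by move: lj; rewrite li codom_f.
rewrite -big_uniq/=; last by rewrite map_inj_uniq ?enum_uniq.
rewrite big_image; apply: eq_bigr => i _; apply/val_inj/funext => S.
rewrite -[RHS]/(s i * slot_functional (j i) f (S (x i))) /x.
by rewrite !linearZ/= -[_ *: _]/(s i * _) mulrA ss mul1r.
Qed.
End SignedUnits.

Lemma l1_unit_inj : injective (@l1_unit R n).
Proof.
move=> i l il; have := l1_unitE (R := R) i i.
rewrite il l1_unitE eqxx; case: eqP => // _ /eqP.
by rewrite eq_sym oner_eq0.
Qed.

Lemma l1_unit_neqN i l : l1_unit i <> - l1_unit l :> l1 R n.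
Proof.
move=> il; have := l1_unitE (R := R) i i; rewrite il mxE l1_unitE eqxx.
by case: (i == l) => /=; lra.
Qed.

Lemma norm_attainment_extreme_points_l1 T : (0 < n)%N -> `|T| = 1 ->
  norm_attainment T `&` extreme_points (unit_ball (l1 R n)) =
  [set a | exists l s,
    [/\ `|s| = 1, `|T (l1_unit l)| = 1 & a = s *: l1_unit l]].
Proof.
move=> n0 T1; rewrite extreme_points_l1//; apply/seteqP; split=> a.
  move=> [[_ Ta] [l [s [s1 aE]]]]; exists l, s; split=> //.
  by move: Ta; rewrite aE linearZ normrZ s1 mul1r T1.
move=> [l [s [s1 Tl ->]]]; split; last by exists l, s.
split; first by rewrite /unit_sphere/= normrZ s1 norm_l1_unit mulr1.
by rewrite linearZ normrZ s1 mul1r T1.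
Qed.

End Smoothness.

(** * Counting dimensions over the norm-attaining extreme points *)

Theorem corollary2p3 (R : realType) (n : nat) (hn : (0 < n)%N)
    (Y : completeNormedModType R) (T : bounded_operator (l1 R n) Y)
    (hT : `|T| = 1) (k : nat) (hk : (0 < k)%N) :
  k_smooth k T <->
  exists (r : nat) (x : 'I_r -> l1 R n),
    [/\ (1 <= r <= n)%N,
        injective x,
        (forall i j, x i <> - x j),
        norm_attainment T `&` extreme_points (unit_ball (l1 R n)) =
          [set y | exists i, y = x i \/ y = - x i] &
        exists m : 'I_r -> nat,
          [/\ (forall i, (0 < m i)%N),
              (forall i, k_smooth (m i) (T (x i))) &
              (\sum_(i < r) m i)%N = k]].
Proof.
rewrite norm_attainment_extreme_points_l1//; split.
  move=> [_ dimT].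
  (* The columns of norm 1 are enumerated by [j]; r is their number, and the x_i are the unit
     vectors with sign 1. *)
  pose A := [pred l | `|T (l1_unit l)| == 1].
  pose j : 'I_#|A| -> 'I_n := enum_val.
  have jP l : `|T (l1_unit l)| = 1 <-> exists i, l = j i.
    split=> [Tl|[i ->]]; last by have := enum_valP i; rewrite inE => /eqP.
    have lA : l \in A by rewrite inE; exact/eqP.
    by exists (enum_rank_in lA l); rewrite /j enum_rankK_in.
  have Tj i : `|T (l1_unit (j i))| = 1 by apply/jP; exists i.
  (* Each summand embeds in span J(T), which is finite-dimensional, so it has some dimension. *)
  have /choice[m mP] i : exists m,
      has_dim (linear_span (support_functionals (T (l1_unit (j i))))) m.
    apply: (has_dim_embedding (f := point_functional (l1_unit (j i))) _ dimT).
    - exact: subspace_linear_span.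
    - apply: linear_span_min.
        have [U0 UL] := subspace_linear_span (support_functionals T).
        split=> [|a g h Ug Uh]; first by rewrite /= linear0.
        by rewrite /= linearP; exact: UL.
      move=> g Jg; apply: sub_linear_span.
      apply: support_point_functional => //; exact: norm_l1_unit.
    - exact: point_functional_inj.
  have mk : (\sum_i m i)%N = k.
    apply: has_dim_unique dimT.
    apply: (has_dim_support_l1 (s := fun=> 1) hT (@enum_val_inj _ _) _ jP).
      by move=> i; rewrite normr1.
    by move=> i; rewrite scale1r.
  have smT i : k_smooth (m i) (T (l1_unit (j i))).
    by split; [exact: Tj|exact: mP].
  exists #|A|, (fun i => l1_unit (j i)); split.
  - apply/andP; split; last by rewrite -[leqRHS]card_ord max_card.
    (* Without a column of norm 1 the sum is empty and [k] would be 0, against [hk]. *)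
    rewrite lt0n; apply/eqP => A0; move: hk.
    rewrite -mk; move: (m); rewrite A0 => m'.
    by rewrite big_ord0.
  - by move=> i1 i2 /l1_unit_inj/enum_val_inj.
  - by move=> i1 i2; exact: l1_unit_neqN.
  - apply/seteqP; split=> a.
      move=> [l [s [s1 /jP[i ->] ->]]]; exists i.
      by have [->|->] := norm_eq1 s1; rewrite ?scale1r ?scaleN1r; [left|right].
    move=> [i [->|->]]; [exists (j i), 1|exists (j i), (-1)].
      by rewrite normr1 scale1r.
    by rewrite normrN1 scaleN1r.
  - by exists m; split=> // i; exact: k_smooth_gt0 (smT i).
move=> [r [x [_ x_inj xN /seteqP[Mx xM] [m [_ smx <-]]]]]; split=> //.
have /choice[j /choice[s js]] i : exists l s,
    [/\ `|s| = 1, `|T (l1_unit l)| = 1 & x i = s *: l1_unit l].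
  by apply: xM; exists i; left.
have s1 i : `|s i| = 1 by have [] := js i.
have xE i : x i = s i *: l1_unit (j i) by have [] := js i.
apply: (has_dim_support_l1 (j := j) (s := s) hT _ s1).
(* Equal indices make x_i1 equal to x_i2 or to its negative; [xN] excludes the latter and [x_inj]
   settles the former. *)
- move=> i1 i2 j12; have := xE i1; rewrite j12 => x1; have := xE i2 => x2.
  have [e1|e1] := norm_eq1 (s1 i1); have [e2|e2] := norm_eq1 (s1 i2);
    rewrite e1 ?scale1r ?scaleN1r in x1; rewrite e2 ?scale1r ?scaleN1r in x2.
  + by apply: x_inj; rewrite x1 x2.
  + by case: (xN i1 i2); rewrite x1 x2 opprK.
  + by case: (xN i1 i2); rewrite x1 x2.
  + by apply: x_inj; rewrite x1 x2.
- move=> l; split=> [Tl|[i ->]]; last by have [] := js i.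
  (* The unit vector of a norm-one column is some x_i up to sign. Unit vectors are never negatives
     of one another, so the index must be [j i]. *)
  have [|i xi] := Mx (l1_unit l).
    by exists l, 1; rewrite normr1 scale1r.
  exists i; move: xi; rewrite xE.
  have [->|->] := norm_eq1 (s1 i); rewrite ?scaleN1r ?scale1r ?opprK.
    by case=> [/l1_unit_inj//|/l1_unit_neqN].
  by case=> [/l1_unit_neqN//|/l1_unit_inj].
- by move=> i; rewrite -xE; have [] := smx i.
Qed.
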